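(* Let $\alpha=1$. Then Hypothesis A (stated in the context) is satisfied: for every real $\xi\neq0$ there exists a configuration of three point vortices, with positions $a_1,a_2,a_3\in\mathbb{C}$ and intensities $\xi_1,\xi_2,\xi_3\in\mathbb{R}\setminus\{0\}$ with $\xi_1+\xi_2+\xi_3=\xi$, having the properties required in Hypothesis A with $\alpha=1$.
   Context: For $\alpha\in(0,3)$, $\alpha\ne2$, let $c_\alpha=-\left(2^\alpha\,\Gamma(\alpha/2)^2\sin(\alpha\pi/2)\right)^{-1}$ (so $c_1=-\frac1{2\pi}$). **Hypothesis A (for a given $\alpha$).** For every real $\xi\ne0$ there exist distinct $a_1,a_2,a_3\in\mathbb{C}$ with $a_1\neq0$, $\xi_1,\xi_2,\xi_3\in\mathbb{R}\setminus\{0\}$ with $\xi_1+\xi_2+\xi_3=\xi$, and $a,b\in\mathbb{R}$ with $a>0$, such that $$i c_\alpha\sum_{k\neq j}\xi_k\frac{|a_j-a_k|^{\alpha-2}}{a_j-a_k}=\bar a_j(a-ib),\qquad j=1,2,3,$$ and such that all eigenvalues of the matrix $$L=\begin{pmatrix}-a-ib&0&L_{13}&L_{14}\\0&-a-ib&L_{23}&L_{24}\\ \overline{L_{13}}&\overline{L_{14}}&-a+ib&0\\ \overline{L_{23}}&\overline{L_{24}}&0&-a+ib\end{pmatrix}$$ have real part equal to $-a$. Here, with $h(w)=(\alpha-2)|w|^{\alpha-4}-\frac{|w|^{\alpha-2}}{w^2}$ for $w\in\mathbb{C}\setminus\{0\}$, $$L_{13}=-\frac{ic_\alpha}{|a_1|^2}\Big[\overline{a_1^2\xi_3h(a_2-a_3)}+\overline{a_1^2\xi_1h(a_2-a_1)}+\frac{a_2}{a_1}\overline{a_1^2\xi_2h(a_1-a_2)}\Big],$$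 $$L_{14}=-\frac{ic_\alpha}{|a_1|^2}\Big[\overline{a_1^2\xi_3h(a_2-a_3)}+\frac{a_2}{a_1}\overline{a_1^2\xi_3h(a_1-a_3)}\Big],$$ $$L_{23}=-\frac{ic_\alpha}{|a_1|^2}\Big[\overline{a_1^2\xi_2h(a_3-a_2)}+\frac{a_3}{a_1}\overline{a_1^2\xi_2h(a_1-a_2)}\Big],$$ $$L_{24}=-\frac{ic_\alpha}{|a_1|^2}\Big[\overline{a_1^2\xi_2h(a_3-a_2)}+\overline{a_1^2\xi_1h(a_3-a_1)}+\frac{a_3}{a_1}\overline{a_1^2\xi_3h(a_1-a_3)}\Big].$$ *)

(* Defs.v *)
From mathcomp Require Import all_boot all_order all_algebra.
From mathcomp Require Import complex.
From mathcomp Require Import all_classical all_reals all_analysis.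

Set Implicit Arguments.
Unset Strict Implicit.
Unset Printing Implicit Defensive.

Import Order.TTheory GRing.Theory Num.Theory.

Local Open Scope classical_set_scope.
Local Open Scope ring_scope.
Local Open Scope complex_scope.

(* Euler's integral; it is the Gamma function for 0 < s only. *)
Definition Gamma (R : realType) (s : R) : R :=
  \int[@lebesgue_measure R]_(t in `]0, +oo[) (t `^ (s - 1) * expR (- t)).

(* Meaningful for alpha in ]0, 3[ with alpha != 2; at alpha = 2 the sine
   vanishes and the value is junk. *)
Definition calpha (R : realType) (alpha : R) : R :=
  - (2 `^ alpha * Gamma (alpha / 2) ^+ 2 * sin (alpha * pi / 2))^-1.

(* |w|^p for a real exponent p, as a complex number. *)
Definition normpow (R : realType) (w : R[i]) (p : R) : R[i] :=
  (Normc.normc w `^ p)%:C.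

Definition hfun (R : realType) (alpha : R) (w : R[i]) : R[i] :=
  (alpha - 2)%:C * normpow w (alpha - 4) - normpow w (alpha - 2) / w ^+ 2.

Definition L13 (R : realType) (alpha : R) (a1 a2 a3 : R[i])
    (xi1 xi2 xi3 : R) : R[i] :=
  - ('i%C * (calpha alpha)%:C / `|a1| ^+ 2) *
  ((a1 ^+ 2 * xi3%:C * hfun alpha (a2 - a3))^*%C +
   (a1 ^+ 2 * xi1%:C * hfun alpha (a2 - a1))^*%C +
   a2 / a1 * (a1 ^+ 2 * xi2%:C * hfun alpha (a1 - a2))^*%C).

Definition L14 (R : realType) (alpha : R) (a1 a2 a3 : R[i])
    (xi1 xi2 xi3 : R) : R[i] :=
  - ('i%C * (calpha alpha)%:C / `|a1| ^+ 2) *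
  ((a1 ^+ 2 * xi3%:C * hfun alpha (a2 - a3))^*%C +
   a2 / a1 * (a1 ^+ 2 * xi3%:C * hfun alpha (a1 - a3))^*%C).

Definition L23 (R : realType) (alpha : R) (a1 a2 a3 : R[i])
    (xi1 xi2 xi3 : R) : R[i] :=
  - ('i%C * (calpha alpha)%:C / `|a1| ^+ 2) *
  ((a1 ^+ 2 * xi2%:C * hfun alpha (a3 - a2))^*%C +
   a3 / a1 * (a1 ^+ 2 * xi2%:C * hfun alpha (a1 - a2))^*%C).

Definition L24 (R : realType) (alpha : R) (a1 a2 a3 : R[i])
    (xi1 xi2 xi3 : R) : R[i] :=
  - ('i%C * (calpha alpha)%:C / `|a1| ^+ 2) *
  ((a1 ^+ 2 * xi2%:C * hfun alpha (a3 - a2))^*%C +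
   (a1 ^+ 2 * xi1%:C * hfun alpha (a3 - a1))^*%C +
   a3 / a1 * (a1 ^+ 2 * xi3%:C * hfun alpha (a1 - a3))^*%C).

(* A and b are the real numbers a and b of the rate a - ib; the positions
   already use the letter a. *)
Definition Lmx (R : realType) (alpha : R) (a1 a2 a3 : R[i])
    (xi1 xi2 xi3 A b : R) : 'M[R[i]]_4 :=
  let l13 := L13 alpha a1 a2 a3 xi1 xi2 xi3 in
  let l14 := L14 alpha a1 a2 a3 xi1 xi2 xi3 in
  let l23 := L23 alpha a1 a2 a3 xi1 xi2 xi3 in
  let l24 := L24 alpha a1 a2 a3 xi1 xi2 xi3 in
  let d := - A%:C - 'i%C * b%:C in
  let d' := - A%:C + 'i%C * b%:C in
  \matrix_(i < 4, j < 4) nth 0 (nth [::]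
    [:: [:: d;      0;      l13; l14];
        [:: 0;      d;      l23; l24];
        [:: l13^*%C;  l14^*%C;  d';  0  ];
        [:: l23^*%C;  l24^*%C;  0;   d' ] ] i) j.

(* The indices 1, 2, 3 of the three vortices are the elements 0, 1, 2 of
   'I_3. *)
Definition hypothesisA (R : realType) (alpha : R) : Prop :=
  forall x : R, x != 0 ->
  exists (a : 'I_3 -> R[i]) (xi : 'I_3 -> R) (A b : R),
    [/\ injective a /\ a 0 != 0,
        (forall j, xi j != 0) /\ \sum_j xi j = x,
        0 < A,
        forall j : 'I_3,
          'i%C * (calpha alpha)%:C *
            (\sum_(k < 3 | k != j)
               (xi k)%:C * (normpow (a j - a k) (alpha - 2) / (a j - a k)))
          = (a j)^*%C * (A%:C - 'i%C * b%:C)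
      & forall z : R[i],
          eigenvalue (Lmx alpha (a 0) (a 1) (a 2) (xi 0) (xi 1) (xi 2) A b) z ->
          complex.Re z = - A].

(* Main.v *)
Require Import Defs.
From mathcomp Require Import all_boot all_order all_algebra.
From mathcomp Require Import complex ring lra.
From mathcomp Require Import all_classical all_reals all_analysis.
From mathcomp Require Import measurable_realfun.

(** Put the vortices at the vertices of a 3-4-5 right triangle whose leg
    [a2 - a3] is vertical. A self-similar triple has zero energy and zero
    relative angular momentum; given the three distances these are two linear
    equations in the inverse intensities, which fixes the intensities up to
    scale. Everything is then rational, up to the common factor
    [calpha 1 * x], and reversing the sign of that factor amounts to reflecting
    the triangle in the real axis.

    For alpha = 1 the function h vanishes on the imaginary axis, so
    [h (a2 - a3) = 0]. This makes the 2 x 2 block [M] of the [L_ij] a matrix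
    [u v^T] of rank one, and the eigenvalues [z] of [L] satisfy
    [z + a = +- ib] or [(z + a)^2 = |<u, v>|^2 - b^2]. The inequality
    [|<u, v>| <= |b|] puts all of them on the line [Re z = - a]. *)

Set Implicit Arguments.
Unset Strict Implicit.
Unset Printing Implicit Defensive.

Import Order.TTheory GRing.Theory Num.Theory numFieldNormedType.Exports.

Local Open Scope classical_set_scope.
Local Open Scope ring_scope.
Local Open Scope complex_scope.

(** * Positivity of Gamma on ]0, 1] and the sign of [calpha 1] *)

Section GammaPositive.
Variable R : realType.
Implicit Types s t a b : R.

Let mu := @lebesgue_measure R.

Lemma powR_le_add1 s t : 0 < s <= 1 -> 0 < t -> t `^ s <= 1 + t.
Proof.
move=> /andP[s0 s1] t0; have [t1|t1] := leP t 1.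
  by have := ge0_ler_powR (ltW s0) (ltW t0) ler01 t1; rewrite powR1; lra.
by have := ler1_powR (ltW t1) s1; lra.
Qed.

Lemma measurable_Gamma_integrand s :
  measurable_fun [set: R] (fun t : R => t `^ (s - 1) * expR (- t)).
Proof.
apply: measurable_funM => //.
by apply: measurableT_comp => //; exact: oppr_measurable.
Qed.

(* Since t^s <= 1 + t, the integrand is at most the derivative of
   - (e / s) * exp (- t^s), which increases from - e / s to 0. *)
Lemma integral_Gamma_segment s a b : 0 < s <= 1 -> 0 < a -> a < b ->
  (\int[mu]_(t in `[a, b]) (t `^ (s - 1) * expR (- t))%:E
     <= (expR 1 / s)%:E)%E.
Proof.
move=> s01 a0 ab; have s0 : 0 < s by lra.
pose F t := - (expR 1 / s) * expR (- t `^ s).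
pose g t := expR 1 * t `^ (s - 1) * expR (- t `^ s).
have dF t : 0 < t -> is_derive t 1 F (g t).
  move=> t0; have d := is_deriveZ (- (expR 1 / s))
    (@is_derive1_comp R expR (- (@powR R ^~ s)) t _ _ (is_derive_expR _)
      (is_deriveN (is_derive1_powR s t0))).
  apply: is_derive_eq d _; rewrite /GRing.scale /= /g; field.
  by rewrite gt_eqF.
have cexp r t : 0 < t -> {for t, continuous (fun u => u `^ r)}.
  move=> t0; apply: differentiable_continuous; apply/derivable1_diffP.
  by apply: derivable_powR; rewrite in_itv /= t0.
have cg : {within `[a, b], continuous g}.
  apply: continuous_in_subspaceT => t; rewrite inE /= in_itv /= => /andP[at_ _].
  have t0 : 0 < t by lra.
  apply: cvgM; first by apply: cvgM; [exact: cvg_cst|exact: cexp].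
  apply: continuous_comp; last exact: continuous_expR.
  by apply: continuousN; exact: cexp.
have dFc t : 0 < t -> {for t, continuous F}.
  move=> t0; apply: differentiable_continuous; apply/derivable1_diffP.
  by have [] := dF t t0.
apply: (@le_trans _ _ (\int[mu]_(t in `[a, b]) (g t)%:E)%E).
  apply: ge0_le_integral => //.
  - by move=> t _; rewrite lee_fin mulr_ge0 ?powR_ge0 ?expR_ge0.
  - by apply/measurable_EFinP; apply: measurable_funS (measurable_Gamma_integrand s).
  - apply/measurable_EFinP; apply: subspace_continuous_measurable_fun cg.
    exact: measurable_itv.
  move=> t; rewrite /= in_itv /= => /andP[at_ _].
  have t0 : 0 < t by lra.
  rewrite lee_fin /g mulrC -mulrA [leRHS]mulrCA [leLHS]mulrC.
  rewrite ler_wpM2l ?powR_ge0// -expRD ler_expR.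
  by have := powR_le_add1 s01 t0; lra.
rewrite (@continuous_FTC2 _ g F)//.
- rewrite -EFinD lee_fin /F.
  have E : 0 < expR 1 / s by rewrite divr_gt0 ?expR_gt0.
  have h1 := expR_gt0 (- b `^ s).
  have : expR (- a `^ s) <= 1 by rewrite -expR0 ler_expR; have := powR_ge0 a s; lra.
  move: (expR (- a `^ s)) (expR (- b `^ s)) h1 => u v h1 h2; nra.
- split.
  + by move=> t; rewrite in_itv /= => /andP[at_ _]; have [] := dF t (lt_trans a0 at_).
  + by apply: cvg_at_right_filter; exact: dFc.
  + by apply: cvg_at_left_filter; apply: dFc; lra.
- move=> t; rewrite in_itv /= => /andP[at_ _].
  by have [_ <-] := dF t (lt_trans a0 at_); rewrite derive1E.
Qed.

(** [Gamma] takes [fine] of an extended integral and [fine] sends +oo to 0, so finiteness is proved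
    along with positivity. The segments [S n] exhaust the half-line and give the bound e / s; on ]0,
    1] the integrand is at least exp (- 1). *)
Lemma Gamma_gt0 s : 0 < s <= 1 -> 0 < Gamma s.
Proof.
move=> s01; have s0 : 0 < s by lra.
pose f t := (t `^ (s - 1) * expR (- t))%:E.
have f0 t : (0 <= f t)%E by rewrite lee_fin mulr_ge0 ?powR_ge0 ?expR_ge0.
have mf D : measurable_fun D f.
  by apply/measurable_EFinP; apply: measurable_funS (measurable_Gamma_integrand s).
(* The shift by 2 keeps the segment nondegenerate, already at [n = 0]. *)
pose S n : set R := `[n.+2%:R^-1, n.+2%:R]%classic.
have S_oo : `]0%R, +oo[%classic = \bigcup_n S n.
  apply/seteqP; split => t /=; last first.
    case=> [n _]; rewrite /S /= !in_itv /= andbT => /andP[h _].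
    by apply: lt_le_trans h; rewrite invr_gt0 ltr0n.
  rewrite in_itv /= andbT => t0.
  exists (Num.truncn (t + t^-1)) => //; rewrite /S /= in_itv /=.
  have i0 : 0 < t^-1 by rewrite invr_gt0.
  have := Num.Theory.truncnS_gt (t + t^-1); set n := Num.truncn _ => hn.
  have hn2 : n.+1%:R < n.+2%:R :> R by rewrite ltr_nat.
  apply/andP; split; last by lra.
  by rewrite invf_ple ?posrE//; lra.
have ub : (\int[mu]_(t in `]0%R, +oo[) f t <= (expR 1 / s)%:E)%E.
  rewrite S_oo.
  have cvgS : (\int[mu]_(t in S n) f t)%E @[n --> \oo] -->
      (\int[mu]_(t in \bigcup_n S n) f t)%E.
    apply: ge0_nondecreasing_set_cvg_integral => //.
    - move=> m n mn; apply/subsetPset => t; rewrite /S /= !in_itv /= => /andP[l u].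
      have mn2 : m.+2%:R <= n.+2%:R :> R by rewrite ler_nat !ltnS.
      rewrite (le_trans u mn2) andbT (le_trans _ l)// lef_pV2 ?posrE//.
    - by move=> n; exact: measurable_itv.
    - by move=> n; exact: mf.
  rewrite -(cvg_lim _ cvgS)//; apply: lime_le.
    by apply/cvg_ex; eexists; exact: cvgS.
  apply: nearW => n; apply: integral_Gamma_segment => //.
  have : 2 <= n.+2%:R :> R by rewrite ler_nat.
  move: (n.+2%:R) => u u2; apply: (@lt_trans _ _ 1); last lra.
  by rewrite invf_lt1; lra.
have lb : ((expR (- 1))%:E <= \int[mu]_(t in `]0%R, +oo[) f t)%E.
  apply: (@le_trans _ _ (\int[mu]_(t in `]0%R, 1%R]) f t)%E); last first.
    apply: ge0_subset_integral => //.
    - exact: mf.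
    by move=> t; rewrite /= !in_itv /= andbT => /andP[].
  apply: (@le_trans _ _ (\int[mu]_(t in `]0%R, 1%R]) (expR (- 1))%:E)%E).
    by rewrite integral_cst//= lebesgue_measure_itv /= lte_fin ltr01 sube0 mule1.
  apply: ge0_le_integral => //.
  - exact: mf.
  move=> t; rewrite /= in_itv /= => /andP[t0 t1]; rewrite lee_fin.
  rewrite -[leLHS]mul1r ler_pM ?expR_ge0 ?ler_expR//; last lra.
  by rewrite -[leLHS](powRr0 t) ger_powR ?t0//; lra.
have E0 := expR_gt0 (- 1 : R).
rewrite /Gamma /Rintegral fine_gt0//; apply/andP; split.
  by apply: lt_le_trans lb; rewrite lte_fin.
by apply: le_lt_trans ub _; rewrite ltry.
Qed.

Lemma calpha1_lt0 : calpha (1 : R) < 0.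
Proof.
rewrite /calpha oppr_lt0 invr_gt0 !mul1r sin_pihalf mulr1 powRr1//.
by rewrite mulr_gt0// exprn_gt0// Gamma_gt0//; lra.
Qed.
End GammaPositive.

(** * Eigenvalues of the matrix L with a rank-one block *)

(** The combinations [p] and [q] satisfy a closed system: [(z - d) * p] is a multiple of [q] and
    [(z - d') * q] a multiple of [p]. Composing the two and cancelling [p] gives the third case;
    [p = 0] would force [q] and then every coordinate to vanish. The primed letters become complex
    conjugates in the application. *)
Lemma eigen_block_rank1 (F : fieldType) (d d' z x0 x1 x2 x3 : F)
    (u1 u2 v1 v2 u1' u2' v1' v2' : F) :
  x0 * d + x2 * (u1' * v1') + x3 * (u2' * v1') = z * x0 ->
  x1 * d + x2 * (u1' * v2') + x3 * (u2' * v2') = z * x1 ->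
  x2 * d' + x0 * (u1 * v1) + x1 * (u2 * v1) = z * x2 ->
  x3 * d' + x0 * (u1 * v2) + x1 * (u2 * v2) = z * x3 ->
  [|| x0 != 0, x1 != 0, x2 != 0 | x3 != 0] ->
  [\/ z = d, z = d' |
      (z - d) * (z - d') = (u1 * v1' + u2 * v2') * (u1' * v1 + u2' * v2)].
Proof.
move=> E0 E1 E2 E3 x_neq0.
have [->|zd] := eqVneq z d; first by constructor 1.
have [->|zd'] := eqVneq z d'; first by constructor 2.
constructor 3.
pose p := x0 * u1 + x1 * u2; pose q := x2 * u1' + x3 * u2'.
have F0 : (z - d) * x0 = v1' * q by rewrite mulrBl -E0 /q; ring.
have F1 : (z - d) * x1 = v2' * q by rewrite mulrBl -E1 /q; ring.
have F2 : (z - d') * x2 = v1 * p by rewrite mulrBl -E2 /p; ring.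
have F3 : (z - d') * x3 = v2 * p by rewrite mulrBl -E3 /p; ring.
have Fp : (z - d) * p = (u1 * v1' + u2 * v2') * q.
  by rewrite /p mulrDr !mulrA F0 F1; ring.
have Fq : (z - d') * q = (u1' * v1 + u2' * v2) * p.
  by rewrite /q mulrDr !mulrA F2 F3; ring.
have p0 : p != 0.
  apply: contraTneq x_neq0 => p0; rewrite !negb_or !negbK.
  move: Fq F2 F3; rewrite p0 !mulr0 => /eqP.
  rewrite !(mulf_eq0, subr_eq0, negPf zd') /= => /eqP q0 /eqP + /eqP.
  rewrite !mulf_eq0 !subr_eq0 !(negPf zd') /= => -> ->.
  move: F0 F1; rewrite q0 !mulr0 => /eqP + /eqP.
  by rewrite !mulf_eq0 !subr_eq0 !(negPf zd) /= => -> ->.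
apply: (mulIf p0); rewrite mulrAC Fp mulrAC -mulrA [_ * q]mulrC -mulrA; congr (_ * _).
by rewrite mulrC Fq.
Qed.

Section RankOne.
Variable R : realType.

Lemma mulcJ_norm (z : R[i]) : z * z^*%C = `|z| ^+ 2.
Proof.
rewrite -add_Re2_Im2; case: z => x y; simpc => /=.
by rewrite !expr2 [y * x]mulrC addNr.
Qed.

(** The order on [R[i]] only relates numbers with equal imaginary parts, so the hypothesis also says
    that the square is real. *)
Lemma Re_sqr_le0 (z : R[i]) : z ^+ 2 <= 0 -> complex.Re z = 0.
Proof.
case: z => x y; rewrite expr2; simpc => /andP[/eqP h1 h2].
have [//|x0] := eqVneq x 0; have y0 : y = 0.
  by apply: (mulfI x0); rewrite mulr0; lra.
have : x ^+ 2 <= 0 by move: h2; rewrite y0 expr2; lra.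
by rewrite exprn_even_le0//= => /eqP.
Qed.

Lemma Re_eigenvalue_Lmx_rank1 (alpha : R) (a1 a2 a3 : R[i]) (xi1 xi2 xi3 A b : R)
    (u1 u2 v1 v2 z : R[i]) :
  L13 alpha a1 a2 a3 xi1 xi2 xi3 = u1 * v1 ->
  L14 alpha a1 a2 a3 xi1 xi2 xi3 = u1 * v2 ->
  L23 alpha a1 a2 a3 xi1 xi2 xi3 = u2 * v1 ->
  L24 alpha a1 a2 a3 xi1 xi2 xi3 = u2 * v2 ->
  `|u1 * v1^*%C + u2 * v2^*%C| <= `|b%:C| ->
  eigenvalue (Lmx alpha a1 a2 a3 xi1 xi2 xi3 A b) z -> complex.Re z = - A.
Proof.
move=> e13 e14 e23 e24 le_b /eigenvalueP[w wL w0].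
(* The indices have the form in which [big_ord_recl] produces them. *)
pose i1 : 'I_4 := lift ord0 ord0; pose i2 : 'I_4 := lift ord0 (lift ord0 ord0).
pose i3 : 'I_4 := lift ord0 (lift ord0 (lift ord0 ord0)).
have : [|| w 0 ord0 != 0, w 0 i1 != 0, w 0 i2 != 0 | w 0 i3 != 0].
  apply: contraNT w0; rewrite !negb_or !negbK => /and4P[/eqP h0 /eqP h1 /eqP h2 /eqP h3].
  apply/eqP/rowP => j; rewrite mxE.
  by case: j => [[|[|[|[|//]]]] jlt];
    [rewrite -h0|rewrite -h1|rewrite -h2|rewrite -h3]; congr (w 0 _); exact: val_inj.
have row_eq j := congr1 (fun m : 'M[R[i]]_(1, 4) => m 0 j) wL.
move: (row_eq ord0) (row_eq i1) (row_eq i2) (row_eq i3).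
rewrite !mxE !big_ord_recl !big_ord0 !mxE /= -/i1 -/i2 -/i3.
rewrite e13 e14 e23 e24 !rmorphM /= => {row_eq wL w0}.
rewrite !(mulr0, addr0, add0r) !addrA.
move: (w 0 ord0) (w 0 i1) (w 0 i2) (w 0 i3) => x0 x1 x2 x3 E0 E1 E2 E3 x_neq0.
have := @eigen_block_rank1 _ (- A%:C - 'i%C * b%:C) (- A%:C + 'i%C * b%:C) z
  x0 x1 x2 x3 u1 u2 v1 v2 u1^*%C u2^*%C v1^*%C v2^*%C _ _ _ _ x_neq0.
case.
- by rewrite -E0; ring.
- by rewrite -E1; ring.
- by rewrite -E2; ring.
- by rewrite -E3; ring.
- by move=> ->; rewrite raddfB raddfN /= !mul0r mul1r subrr subr0.
- by move=> ->; rewrite raddfD raddfN /= !mul0r mul1r subrr addr0.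
have -> : (z - (- A%:C - 'i%C * b%:C)) * (z - (- A%:C + 'i%C * b%:C))
    = (z + A%:C) ^+ 2 - ('i%C) ^+ 2 * b%:C ^+ 2 by ring.
have -> : u1^*%C * v1 + u2^*%C * v2 = (u1 * v1^*%C + u2 * v2^*%C)^*%C.
  by rewrite rmorphD !rmorphM /= !conjcK.
rewrite sqr_i mulN1r opprK mulcJ_norm => zA2.
suff : complex.Re (z + A%:C) = 0 by rewrite raddfD /=; lra.
apply: Re_sqr_le0; rewrite -(lerD2r (b%:C ^+ 2)) zA2 add0r.
have -> : b%:C ^+ 2 = `|b%:C| ^+ 2 :> R[i] by rewrite -mulcJ_norm conjc_real expr2.
by rewrite lerXn2r ?nnegrE.
Qed.

(** A center of vorticity at 0 gives [xi1 + xi2 * a2 / a1 = - xi3 * a3 / a1], and likewise with 2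
    and 3 exchanged. This collapses the brackets of [L13] and [L24], and the block becomes u v^T
    with u = (xi3, - xi2). *)
Lemma L_factor_hfun0 (alpha : R) (a1 a2 a3 : R[i]) (xi1 xi2 xi3 : R) :
  a1 != 0 -> xi1%:C * a1 + xi2%:C * a2 + xi3%:C * a3 = 0 ->
  hfun alpha (a2 - a3) = 0 ->
  let k := 'i%C * (calpha alpha)%:C / `|a1| ^+ 2 in
  let v1 := k * (a3 / a1) * (a1 ^+ 2 * hfun alpha (a1 - a2))^*%C in
  let v2 := - (k * (a2 / a1) * (a1 ^+ 2 * hfun alpha (a1 - a3))^*%C) in
  [/\ L13 alpha a1 a2 a3 xi1 xi2 xi3 = xi3%:C * v1,
      L14 alpha a1 a2 a3 xi1 xi2 xi3 = xi3%:C * v2,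
      L23 alpha a1 a2 a3 xi1 xi2 xi3 = - xi2%:C * v1 &
      L24 alpha a1 a2 a3 xi1 xi2 xi3 = - xi2%:C * v2].
Proof.
move=> a1_neq0 center h23 k v1 v2.
have hN w : hfun alpha (- w) = hfun alpha w.
  rewrite /hfun /normpow sqrrN; congr (_ * (_ `^ _)%:C - (_ `^ _)%:C / _);
  by case: w => x y /=; rewrite !sqrrN.
have h32 : hfun alpha (a3 - a2) = 0 by rewrite -opprB hN.
have h21 : hfun alpha (a2 - a1) = hfun alpha (a1 - a2) by rewrite -opprB hN.
have h31 : hfun alpha (a3 - a1) = hfun alpha (a1 - a3) by rewrite -opprB hN.
rewrite /L13 /L14 /L23 /L24 h23 h32 h21 h31 -/k /v1 /v2 {v1 v2 h23 h32 h21 h31 hN}.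
rewrite !mulr0 !rmorph0 !add0r !rmorphM /= !oppr0 !complexr0.
move: (hfun _ _)^*%C (hfun _ _)^*%C k => h12 h13 k.
have -> : xi1%:C = - (xi2%:C * a2 + xi3%:C * a3) / a1.
  by apply: (mulIf a1_neq0); rewrite divfK//; apply/eqP; rewrite -addr_eq0 addrA center.
by split; field.
Qed.

Lemma ler_normc (x y x' y' : R) :
  x ^+ 2 + y ^+ 2 <= x' ^+ 2 + y' ^+ 2 ->
  Normc.normc (x +i* y) <= Normc.normc (x' +i* y').
Proof. by move=> le; rewrite /Normc.normc ler_sqrt// addr_ge0 ?sqr_ge0. Qed.

Lemma norm_conjc (z : R[i]) : `|z^*%C| = `|z|.
Proof. by rewrite !normc_def; case: z => x y /=; rewrite sqrrN. Qed.

(** For the factors above, |<u, v>| equals |c Q| / |a1|, so the rank-one criterion takes a form free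
    of division by [a1]. *)
Lemma Re_eigenvalue_Lmx_hfun0 (alpha : R) (a1 a2 a3 : R[i])
    (xi1 xi2 xi3 A b : R) (z : R[i]) :
  a1 != 0 -> xi1%:C * a1 + xi2%:C * a2 + xi3%:C * a3 = 0 ->
  hfun alpha (a2 - a3) = 0 ->
  `|(calpha alpha)%:C * (xi3%:C * a3 * (hfun alpha (a1 - a2))^*%C
      + xi2%:C * a2 * (hfun alpha (a1 - a3))^*%C)| <= `|b%:C * a1| ->
  eigenvalue (Lmx alpha a1 a2 a3 xi1 xi2 xi3 A b) z -> complex.Re z = - A.
Proof.
move=> a1_neq0 center h23 le_b.
have [e13 e14 e23 e24] := L_factor_hfun0 a1_neq0 center h23.
apply: (Re_eigenvalue_Lmx_rank1 e13 e14 e23 e24).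
set c := (calpha alpha)%:C in le_b e13 e14 e23 e24 *.
set h12 := hfun alpha (a1 - a2) in le_b e13 e14 e23 e24 *.
set h13 := hfun alpha (a1 - a3) in le_b e13 e14 e23 e24 *.
set Q := (X in `|c * X|) in le_b.
set k := 'i%C * c / _.
have conjE (v v' : R[i]) :
    xi3%:C * v^*%C + - xi2%:C * v'^*%C = (xi3%:C * v - xi2%:C * v')^*%C.
  by rewrite rmorphB !rmorphM /= oppr0 mulNr.
rewrite conjE norm_conjc !rmorphM /=.
rewrite [X in `|X|](_ : _ = k * (a1^*%C ^+ 2 / a1) * Q); last first.
  by rewrite /Q; ring.
rewrite !normrM !normfV !normrX norm_conjc.
have normi : `|'i%C : R[i]| = 1 by rewrite normc_def /= expr0n expr1n add0r sqrtr1.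
move: le_b; rewrite !normrM normi mul1r normr_id.
have : 0 < `|a1| by rewrite normr_gt0.
move: `|a1| => r r_gt0 le_b.
rewrite (_ : _ * _ = `|c| * `|Q| / r); last by field; rewrite gt_eqF.
by rewrite ler_pdivrMr.
Qed.

(** * The kernel and [hfun] in coordinates at alpha = 1 *)

(** The value is conj w / |w|^3; supplying |w| as [l] avoids square roots. *)
Lemma normpow_div (x y l : R) : 0 < l -> x ^+ 2 + y ^+ 2 = l ^+ 2 ->
  normpow (x +i* y) (1 - 2) / (x +i* y) = (x / l ^+ 3 -i* (y / l ^+ 3))%C.
Proof.
move=> l_gt0 xyl.
rewrite /normpow /Normc.normc xyl sqrtr_sqr gtr0_norm//.
have -> : 1 - 2 = - 1%:R :> R by ring.
rewrite powR_invn ?ltW// expr1.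
rewrite -[(_ +i* _)^-1]/(Complex _ _) -[LHS]/(Complex _ _) /= xyl.
by congr Complex; field; rewrite gt_eqF.
Qed.

(* For alpha = 1, h w = - 2 (Re w) (conj w) / |w|^5; in particular h vanishes
   on the imaginary axis. *)
Lemma hfun1 (x y l : R) : 0 < l -> x ^+ 2 + y ^+ 2 = l ^+ 2 ->
  hfun 1 (x +i* y) = (- (2 * x ^+ 2 / l ^+ 5) +i* (2 * x * y / l ^+ 5))%C.
Proof.
move=> l_gt0 xyl; have l_neq0 : l != 0 by rewrite gt_eqF.
rewrite /hfun [X in _ / X]expr2 invfM mulrA (normpow_div l_gt0 xyl).
rewrite /normpow /Normc.normc xyl sqrtr_sqr gtr0_norm//.
have -> : 1 - 4 = - 3%:R :> R by ring.
rewrite powR_invn ?ltW//.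
rewrite -[(_ +i* _)^-1]/(Complex _ _) -[LHS]/(Complex _ _) /= xyl.
have y2 : y ^+ 2 = l ^+ 2 - x ^+ 2 by rewrite -xyl addrC addKr.
congr Complex; last by field.
have -> : - (y / l ^+ 3) * - (y / l ^+ 2) = (l ^+ 2 - x ^+ 2) / l ^+ 5.
  by rewrite -y2; field.
by field.
Qed.

End RankOne.

(** * The explicit 3-4-5 configuration *)

Theorem theorem3p1 (R : realType) : hypothesisA (1 : R).
Proof.
move=> x x_neq0.
have [c cE] : exists c, calpha (1 : R) = c by eexists.
have c_lt0 : c < 0 by rewrite -cE calpha1_lt0.
(* [sg] is the sign of [c * x]; it makes the rate [A] positive. *)
have [sg sg1 s_gt0] : exists2 sg : R, sg = 1 \/ sg = -1 & 0 < sg * (c * x).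
  have cx_neq0 : c * x != 0 by rewrite mulf_neq0// lt_eqF.
  have [cx_gt0|cx_le0] := ltP 0 (c * x).
    by exists 1; [left|rewrite mul1r].
  by exists (-1); [right|rewrite mulN1r oppr_gt0 lt_neqAle cx_neq0].
(* The inverse intensities 183, -392, 185 are orthogonal to
   (1 / l23, 1 / l13, 1 / l12) and to (l23^2, l13^2, l12^2), where
   l23 = 3, l13 = 4, l12 = 5 are the distances; the center of vorticity is
   at 0, and sg reflects the triangle. *)
pose V : R := (392 * 185 - 183 * 185 + 183 * 392)^-1.
(* These are 1/183, -1/392, 1/185 multiplied by 183 * 392 * 185 * V, with [V] making their sum 1;
   the intensities are [x * w1], [x * w2], [x * w3]. *)
pose w1 := 392 * 185 * V; pose w2 := - (183 * 185) * V; pose w3 := 183 * 392 * V.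
(* The right angle is at [a3], with [a1 = a3 - 4] and [a2 = a3 + 3 * sg * i]; the vanishing of the
   weighted sum then determines [a3]. *)
pose a1 := (4 * w1 - 4) -i* (sg * (3 * w2)).
pose a2 := (4 * w1) +i* (sg * (3 - 3 * w2)).
pose a3 := (4 * w1) -i* (sg * (3 * w2)).
(* The equation of a single vortex is linear in [A] and [b] and determines them; all three equations
   are checked below. *)
pose A := sg * (c * x) * (37 * 61 * 49 / 150 * V).
pose b := - (c * x) * (43 * 1153 / 25 * V).
have VE : 392 * 185 * V - 183 * 185 * V + 183 * 392 * V = 1.
  by rewrite /V -mulrBl -mulrDl mulfV; last by apply: lt0r_neq0; lra.
have V_gt0 : 0 < V by lra.
have l3 : 0 < 3 :> R by [].
have l4 : 0 < 4 :> R by [].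
have l5 : 0 < 5 :> R by [].
have sg2 : sg ^+ 2 = 1 by case: sg1 => ->; ring.
have a12 : a1 - a2 = (- 4) +i* (- (sg * 3)) by simpc; congr Complex; ring.
have a21 : a2 - a1 = 4 +i* (sg * 3) by simpc; congr Complex; ring.
have a13 : a1 - a3 = (- 4) +i* 0 by simpc; congr Complex; ring.
have a31 : a3 - a1 = 4 +i* 0 by simpc; congr Complex; ring.
have a23 : a2 - a3 = 0 +i* (sg * 3) by simpc; congr Complex; ring.
have a32 : a3 - a2 = 0 +i* (- (sg * 3)) by simpc; congr Complex; ring.
have n12 : (- 4) ^+ 2 + (- (sg * 3)) ^+ 2 = 5 ^+ 2 :> R.
  by rewrite !sqrrN exprMn sg2; ring.
have n21 : 4 ^+ 2 + (sg * 3) ^+ 2 = 5 ^+ 2 :> R by rewrite exprMn sg2; ring.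
have n13 : (- 4) ^+ 2 + 0 ^+ 2 = 4 ^+ 2 :> R by ring.
have n31 : 4 ^+ 2 + 0 ^+ 2 = 4 ^+ 2 :> R by ring.
have n23 : 0 ^+ 2 + (sg * 3) ^+ 2 = 3 ^+ 2 :> R by rewrite exprMn sg2; ring.
have n32 : 0 ^+ 2 + (- (sg * 3)) ^+ 2 = 3 ^+ 2 :> R.
  by rewrite sqrrN exprMn sg2; ring.
have neq_of_sub (u v : R[i]) (p q : R) : u - v = p +i* q ->
    (p != 0) || (q != 0) -> u != v.
  by move=> uv pq; rewrite -subr_eq0 uv eq_complex negb_and.
have sg_neq0 : sg != 0 by case: sg1 => ->; rewrite ?oppr_eq0 oner_eq0.
have d12 : a1 != a2 by apply: neq_of_sub a12 _; rewrite oppr_eq0 pnatr_eq0.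
have d13 : a1 != a3 by apply: neq_of_sub a13 _; rewrite oppr_eq0 pnatr_eq0.
have d23 : a2 != a3.
  by apply: neq_of_sub a23 _; rewrite eqxx mulf_neq0// pnatr_eq0.
have a1_neq0 : a1 != 0.
  by rewrite eq_complex /=; apply/nandP; left;
    apply/eqP; rewrite /w1 => h; lra.
exists (fun j => nth 0 [:: a1; a2; a3] j).
exists (fun j => x * nth 0 [:: w1; w2; w3] j).
exists A; exists b; split.
- split=> // j k.
  case: j k => [[|[|[|//]]] jlt] [[|[|[|//]]] klt] /= ajk; apply: val_inj => //=;
    by move/eqP: ajk; rewrite ?(negPf d12) ?(negPf d13) ?(negPf d23)
      1?eq_sym ?(negPf d12) ?(negPf d13) ?(negPf d23).
- split.
    by case=> [[|[|[|//]]]] jlt /=; rewrite mulf_neq0//;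
      apply/eqP; rewrite /w1 /w2 /w3 => h; lra.
  rewrite !big_ord_recl big_ord0 /= -{4}[x]mulr1 -VE /w1 /w2 /w3; ring.
- by rewrite /A mulr_gt0//; lra.
- rewrite cE => j; have Wn : 392 * 185 - 183 * 185 + 183 * 392 != 0 :> R.
    by apply: lt0r_neq0; lra.
  rewrite big_mkcond !big_ord_recl big_ord0.
  case: j => [[|[|[|//]]]] jlt /=.
  + rewrite a12 a13 (normpow_div l5 n12) (normpow_div l4 n13); simpc.
    by congr Complex; rewrite /A /b /w1 /w2 /w3 /V; case: sg1 => ->; field.
  + rewrite a21 a23 (normpow_div l5 n21) (normpow_div l3 n23); simpc.
    by congr Complex; rewrite /A /b /w1 /w2 /w3 /V; case: sg1 => ->; field.
  + rewrite a31 a32 (normpow_div l4 n31) (normpow_div l3 n32); simpc.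
    by congr Complex; rewrite /A /b /w1 /w2 /w3 /V; case: sg1 => ->; field.
- have w1E : w1 = 1 - w2 - w3 by rewrite -VE /w1 /w2 /w3; ring.
  move=> z.
  apply: (@Re_eigenvalue_Lmx_hfun0 R 1 a1 a2 a3 (x * w1) (x * w2) (x * w3)).
  + exact: a1_neq0.
  + by simpc; congr Complex; rewrite w1E; ring.
  + by rewrite a23 (hfun1 l3 n23); congr Complex; ring.
  rewrite a12 a13 (hfun1 l5 n12) (hfun1 l4 n13) cE; simpc; apply: ler_normc.
  (* Compare squared moduli: the sign [sg] drops out and [(c * x) ^+ 2] factors out. *)
  rewrite -subr_ge0 [X in 0 <= X](_ : _ = (c * x) ^+ 2 *
    ((43 * 1153 / 25 * V) ^+ 2 * ((4 * (w2 + w3)) ^+ 2 + (3 * w2) ^+ 2)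
     - ((w3 * (- 128 * w1 - 72 * w2) / 3125 - w1 * w2 / 8) ^+ 2
        + (w3 * (96 * (w2 - w1)) / 3125 - 3 * w2 * (w1 + w3) / 32) ^+ 2))).
    apply: mulr_ge0; first exact: sqr_ge0.
    (* The remaining factor is homogeneous of degree 4 in [V], which leaves an inequality between
       explicit rationals. *)
    rewrite [X in 0 <= X](_ : _ = (V ^+ 2) ^+ 2 *
      ((43 * 1153 / 25) ^+ 2
         * ((4 * (183 * 392 - 183 * 185)) ^+ 2 + (3 * (183 * 185)) ^+ 2)
       - (((183 * 392) * (- 128 * (392 * 185) + 72 * (183 * 185)) / 3125
             + (392 * 185) * (183 * 185) / 8) ^+ 2
          + ((183 * 392) * (- 96 * (183 * 185 + 392 * 185)) / 3125
             + 3 * (183 * 185) * (392 * 185 + 183 * 392) / 32) ^+ 2))).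
      by apply: mulr_ge0; [exact: sqr_ge0|lra].
    by rewrite /w1 /w2 /w3; field.
  by rewrite /b w1E; case: sg1 => ->; field.
Qed.
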